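(* Let $L\in\{\operatorname{Im}(\mathbb{I}),\mathbb{I}_0\}$ and let $\Lambda=\Lambda_{\rm ico}(t,W)$ be an icosahedral model set with underlying $\mathbb{Z}$-module $L$ (where $t\in\mathbb{R}^3$ and $W\subset\mathbb{R}^3$ is a window). Further, let $U\subset\mathbb{S}^2$ be an arbitrary, but fixed finite set of pairwise non-parallel $L$-directions. Then $\mathcal{F}(\Lambda)$ is not determined by the $X$-rays in the directions of $U$.
   Context: Notation: $\tau=(1+\sqrt5)/2$; $.'$ is the non-trivial Galois automorphism of $\mathbb{Q}(\tau)$, so $\tau'=1-\tau$; $\mathbb{Z}[\tau]=\mathbb{Z}\oplus\mathbb{Z}\tau$. Modules: The icosian ring $\mathbb{I}$ is the additive subgroup of the Hamiltonian quaternions $\mathbb{H}\cong\mathbb{R}^4$ (basis $1,i,j,k$) generated by all even permutations of the coordinates of $(\pm1,0,0,0)$, $\tfrac12(\pm1,\pm1,\pm1,\pm1)$, $\tfrac12(0,\pm1,\pm\tau',\tau)$. For $\alpha=a+bi+cj+dk$ put $\operatorname{Im}(\alpha)=(b,c,d)^t\in\mathbb{R}^3$. $\operatorname{Im}(\mathbb{I})$ is the set of imaginary parts of all elements of $\mathbb{I}$, and $\mathbb{I}_0$ is the set of imaginary parts of those elements of $\mathbb{I}$ with real part $0$. Explicitly, $\operatorname{Im}(\mathbb{I})=\tfrac12\{(\beta,\gamma,\delta)^t\in\mathbb{Z}[\tau]^3\mid\tau^2\beta+\tau\gamma+\delta\equiv0\ (\mathrm{mod}\ 2)\}$ and $\mathbb{I}_0=\tfrac12\{(\beta,\gamma,\delta)^t\in\mathbb{Z}[\tau]^3\mid\beta\equiv\tau\gamma\equiv\tau^2\delta\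 (\mathrm{mod}\ 2)\}$. The star map $.^\star$ applies $.'$ to each coordinate of an element of $\mathbb{Q}(\tau)^3\supset L$. Icosahedral model sets: A window is a set $W\subset\mathbb{R}^3$ with $\varnothing\neq\operatorname{int}(W)\subset W\subset\operatorname{cl}(\operatorname{int}(W))$ and $\operatorname{cl}(\operatorname{int}(W))$ compact. For a window $W$ and $t\in\mathbb{R}^3$, the icosahedral model set with underlying $\mathbb{Z}$-module $L$ is $\Lambda_{\rm ico}(t,W)=t+\{\alpha\in L\mid\alpha^\star\in W\}$. Directions and $X$-rays: A direction is an element of the unit sphere $\mathbb{S}^2\subset\mathbb{R}^3$; an $L$-direction is a direction parallel to a non-zero element of $L-L=L$. For a finite set $F\subset\mathbb{R}^3$ and a direction $u$, the $X$-ray $X_uF$ is the function assigning to each line $\ell$ in $\mathbb{R}^3$ parallel to $u$ the number $\operatorname{card}(F\cap\ell)$. A set $\mathcal{E}$ of finite subsets of $\mathbb{R}^3$ is determined by the $X$-rays in the directions of a finite set $U\subset\mathbb{S}^2$ if for all $F,F'\in\mathcal{E}$, $X_uF=X_uF'$ for all $u\in U$ implies $F=F'$. $\mathcal{F}(\Lambda)$ is the set of all finite subsets of $\Lambda$. *)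

(* Defs.v *)
From HB Require Import structures.
From mathcomp Require Import all_boot all_order all_fingroup all_algebra.
From mathcomp Require Import finmap.
From mathcomp Require Import all_classical all_reals all_analysis.

Set Implicit Arguments.
Unset Strict Implicit.
Unset Printing Implicit Defensive.

Import Order.TTheory GRing.Theory Num.Theory.
Import numFieldNormedType.Exports.

Local Open Scope classical_set_scope.
Local Open Scope ring_scope.

(* Elements of R^3 are row vectors 'rV[R]_3; the quaternion a + bi + cj + dk is
   the row vector (a, b, c, d) : 'rV[R]_4, since only the additive structure of
   the quaternions plays a role. *)

Section Icosians.
Variable R : realType.

Definition tau : R := (1 + Num.sqrt 5) / 2.
Definition tau' : R := 1 - tau.

(* The automorphism a + b tau |-> a + b tau' of Q(tau), extended by 0 to R;
   see galoisE. *)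
Definition galois (x : R) : R :=
  xget 0 [set y | exists a b : rat,
    x = ratr a + ratr b * tau /\ y = ratr a + ratr b * tau'].

Definition star (v : 'rV[R]_3) : 'rV[R]_3 := map_mx galois v.

Definition quat (a b c d : R) : 'rV[R]_4 :=
  \row_(i < 4) [:: a; b; c; d]`_i.

Definition im (q : 'rV[R]_4) : 'rV[R]_3 := \row_(i < 3) q 0 (lift ord0 i).

(* Independent choices of signs are encoded by Booleans, as (-1) ^+ e. *)
Definition icosian_seeds : set 'rV[R]_4 := [set q |
  [\/ exists e : bool, q = quat ((-1) ^+ e) 0 0 0,
      exists e1 e2 e3 e4 : bool,
        q = 2^-1 *: quat ((-1) ^+ e1) ((-1) ^+ e2) ((-1) ^+ e3) ((-1) ^+ e4)
    | exists e1 e2 : bool,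
        q = 2^-1 *: quat 0 ((-1) ^+ e1) ((-1) ^+ e2 * tau') tau]].

Definition icosian_generators : set 'rV[R]_4 :=
  [set q | exists s : 'S_4, ~~ odd_perm s /\
     exists2 v, icosian_seeds v & q = col_perm s v].

Definition icosians : set 'rV[R]_4 :=
  smallest [set M : set 'rV[R]_4 | zmod_closed (mem M)] icosian_generators.

Definition ImI : set 'rV[R]_3 := im @` icosians.

Definition I0 : set 'rV[R]_3 := im @` [set q | icosians q /\ q 0 0 = 0].

End Icosians.

Arguments tau {R}.
Arguments tau' {R}.

Section ModelSets.
Variable R : realType.
Implicit Types (L W : set 'rV[R]_3) (t : 'rV[R]_3).

Definition window W : Prop :=
  [/\ W° !=set0, W° `<=` W, W `<=` closure (W°) & compact (closure (W°))].

Definition model_set L t W : set 'rV[R]_3 :=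
  [set t + alpha | alpha in [set alpha | L alpha /\ W (star alpha)]].

End ModelSets.

Section XRays.
Variable R : realType.
Implicit Types (L F Lambda U : set 'rV[R]_3) (E : set (set 'rV[R]_3)).
Implicit Types (u v : 'rV[R]_3).

(* The library norm on 'rV[R]_3 is the sup norm, hence the explicit Euclidean
   condition. *)
Definition sphere2 : set 'rV[R]_3 := [set u | \sum_(i < 3) u 0 i ^+ 2 = 1].

(* Intended for non-zero vectors. *)
Definition parallel u v : Prop := exists2 c : R, c != 0 & u = c *: v.

Definition Ldirection L u : Prop :=
  sphere2 u /\ exists alpha, [/\ L alpha, alpha != 0 & parallel u alpha].

Definition line x u : set 'rV[R]_3 := [set x + s *: u | s in [set: R]].

Definition lines_along u : set (set 'rV[R]_3) := range (fun x => line x u).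

(* Meant for finite F: fset_set is empty on infinite sets. *)
Definition Xray u F : lines_along u -> nat :=
  fun l => #|` fset_set (F `&` \val l)|%fset.
Arguments Xray u F l : clear implicits.

Definition determined_by_Xrays E U : Prop :=
  forall F F', E F -> E F' -> (forall u, U u -> Xray u F = Xray u F') -> F = F'.

Definition finite_subsets Lambda : set (set 'rV[R]_3) :=
  [set F | finite_set F /\ F `<=` Lambda].

End XRays.

Arguments Xray {R} u F l.

Section GaloisFacts.
Variable R : realType.

Lemma rat_sqr_neq5 (r : rat) : r ^+ 2 != 5.
Proof.
apply/eqP => h.
have d0 : (denq r)%:~R != 0 :> rat by rewrite intr_eq0 denq_eq0.
have h1 : (numq r) ^+ 2 = 5 * (denq r) ^+ 2 :> int.
  apply: (@intr_inj rat); rewrite !expr2 !intrM -!expr2 (_ : 5%:~R = r ^+ 2) ?h // -h -exprMn.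
  by rewrite numqE.
have h2 : (`|numq r| ^ 2 = 5 * `|denq r| ^ 2)%N.
  by move: (congr1 absz h1); rewrite abszM !abszX.
have dn : (0 < `|denq r|)%N by rewrite absz_gt0 denq_eq0.
have := congr1 (fun n => odd (logn 5 n)) h2.
by rewrite lognM ?expn_gt0 ?dn // !lognX oddD !oddM.
Qed.

Lemma tau_basis_inj (a b a' b' : rat) :
  ratr a + ratr b * tau = ratr a' + ratr b' * tau :> R -> a = a' /\ b = b'.
Proof.
move=> h.
have h1 : ratr (b - b') * tau = ratr (a' - a) :> R.
  have e : ratr b * tau = ratr a' + ratr b' * tau - ratr a :> R.
    by rewrite -h addrAC subrr add0r.
  by rewrite !rmorphB /= mulrBl e addrAC addrK.
have [bb|bb] := eqVneq b b'.
  by move: h; rewrite bb => /addIr /fmorph_inj.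
have c0 : (ratr (b - b') : R) != 0 by rewrite fmorph_eq0 subr_eq0.
have h2 : tau = ratr ((a' - a) / (b - b')) :> R.
  by rewrite fmorph_div /= -h1 mulrAC divff ?mul1r.
have h3 : Num.sqrt 5 = ratr (2 * ((a' - a) / (b - b')) - 1) :> R.
  rewrite rmorphB rmorphM /= -h2 rmorph1 ratr_nat /tau mulrC mulfVK ?pnatr_eq0 //.
  by rewrite addrC addrA addNr add0r.
have := congr1 (fun x => x ^+ 2) h3.
rewrite sqr_sqrtr ?ler0n // -rmorphXn /= -(ratr_nat R 5) => /fmorph_inj /esym/eqP.
by rewrite (negbTE (rat_sqr_neq5 _)).
Qed.

Lemma galoisE (a b : rat) :
  galois (ratr a + ratr b * tau) = ratr a + ratr b * tau' :> R.
Proof.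
rewrite /galois; case: xgetP => [y _ [a' [b' [/tau_basis_inj[<- <-] ->]]] //|].
by move=> /(_ (ratr a + ratr b * tau')) []; exists a, b.
Qed.

End GaloisFacts.

(* Main.v *)
Require Import Defs.
From HB Require Import structures.
From mathcomp Require Import all_boot all_order all_fingroup all_algebra.
From mathcomp Require Import finmap.
From mathcomp Require Import all_classical all_reals all_analysis.
From mathcomp Require Import ring lra.

Set Implicit Arguments.
Unset Strict Implicit.
Unset Printing Implicit Defensive.

Import Order.TTheory GRing.Theory Num.Theory.
Import numFieldNormedType.Exports.

Local Open Scope classical_set_scope.
Local Open Scope ring_scope.

(** Both modules lie between [Z[tau]^3] and [(1/2) Z[tau]^3], so every
    direction of [U] is parallel to a non-zero vector of [M = Z[tau]^3], and a
    pair of distinct finite sets with equal X-rays may be sought inside [M],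
    which, being closed under addition and under multiplication by [tau], is
    easier to handle than [L].

    Ignoring the window, such a pair exists for every finite set of directions
    ([switching_component]).  Start from [{0}] and the empty set.  If disjoint
    [S], [T] have equal X-rays in the directions treated so far and [w] is
    parallel to one more direction, then [S U (w + T)] and [T U (w + S)] still
    agree in the old directions, because X-rays commute with translations, and
    they agree in the new one, where translation by [w] changes no count.
    Taking for [w] a large multiple of a vector of [M] keeps the unions
    disjoint.

    The pair is then brought into the window ([contract_into_window]).
    Multiplication by [tau ^ k] preserves [M], while it multiplies star images
    by [tau' ^ k], which tends to [0] as [|tau'| < 1]; and the star image of
    [M] is dense in [R^3].  So some map [x |-> w + tau ^ k x] with [w] in [M]
    sends the pair to elements of [M] with star images in a small ball inside
    the window.  As an injective homothety it preserves both distinctness and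
    equality of X-rays ([line_count_affine_eq]).

    The star map is always handled through the relation [conjugates v w],
    saying that [v] is in [M] and [w] is its star image: this relation is
    visibly compatible with sums and products, whereas the star map on all of
    [R^3] is not. *)

(** * Galois conjugates in [Z[tau]] and density of the star image *)

Section Conjugates.
Variable R : realType.
Implicit Types (x y : R) (v w : 'rV[R]_3) (q : 'rV[R]_4).

Lemma tau_sqr : (tau : R) ^+ 2 = tau + 1.
Proof.
have : (Num.sqrt 5 : R) ^+ 2 = 5 by rewrite sqr_sqrtr.
by rewrite /tau; move: (Num.sqrt 5) => r; nra.
Qed.

Lemma tau'_sqr : (tau' : R) ^+ 2 = tau' + 1.
Proof. by have := tau_sqr; rewrite /tau'; nra. Qed.

Lemma tau_neq0 : (tau : R) != 0.
Proof. by apply/eqP => t0; have := tau_sqr; rewrite t0; lra. Qed.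

Lemma tau'_neq0 : (tau' : R) != 0.
Proof. by apply/eqP => t0; have := tau'_sqr; rewrite t0; lra. Qed.

Lemma normr_tau'_lt1 : `|tau' : R| < 1.
Proof.
have s0 : 0 <= (Num.sqrt 5 : R) by exact: sqrtr_ge0.
have : (Num.sqrt 5 : R) ^+ 2 = 5 by rewrite sqr_sqrtr.
by rewrite ltr_norml /tau' /tau; move: (Num.sqrt 5) s0 => r r0 r2; apply/andP; split; nra.
Qed.

Lemma tau'_expr_small (e : R) : 0 < e -> exists k : nat, `|(tau' : R) ^+ k| < e.
Proof.
move=> e0; have /cvgrPdist_lt/(_ e e0) := cvg_expr normr_tau'_lt1.
by move=> [k _ /(_ k (leqnn k))] /=; rewrite sub0r normrN; exists k.
Qed.

Definition conjugate x y : Prop :=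
  exists a b : int, x = a%:~R + b%:~R * tau /\ y = a%:~R + b%:~R * tau'.

Lemma conjugate_int (n : int) : conjugate n%:~R n%:~R.
Proof. by exists n, 0; rewrite !mul0r !addr0. Qed.

Lemma conjugate_tau : conjugate tau tau'.
Proof. by exists 0, 1; rewrite !mul1r !add0r. Qed.

Lemma conjugateN x y : conjugate x y -> conjugate (- x) (- y).
Proof.
by move=> [a [b [-> ->]]]; exists (- a), (- b); rewrite !rmorphN /=; split; ring.
Qed.

Lemma conjugateD x x1 y y1 :
  conjugate x y -> conjugate x1 y1 -> conjugate (x + x1) (y + y1).
Proof.
move=> [a [b [-> ->]]] [c [d [-> ->]]]; exists (a + c), (b + d).
by rewrite !rmorphD /=; split; ring.
Qed.

Lemma conjugateM x x1 y y1 :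
  conjugate x y -> conjugate x1 y1 -> conjugate (x * x1) (y * y1).
Proof.
move=> [a [b [-> ->]]] [c [d [-> ->]]].
exists (a * c + b * d), (a * d + b * c + b * d).
rewrite !rmorphD !rmorphM /=; split.
  by have := tau_sqr; move: tau => z z2; ring: z2.
by have := tau'_sqr; move: tau' => z z2; ring: z2.
Qed.

Lemma conjugateX x y k : conjugate x y -> conjugate (x ^+ k) (y ^+ k).
Proof.
move=> xy; elim: k => [|k ih]; first exact: (conjugate_int 1).
by rewrite !exprS; exact: conjugateM.
Qed.

Lemma galois_conjugate x y : conjugate x y -> galois x = y.
Proof.
by move=> [a [b [-> ->]]]; have := galoisE R a%:~R b%:~R; rewrite !ratr_int.
Qed.

(** The conjugates [n tau' ^ k] of the numbers [n tau ^ k], with [n] an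
    integer, already form a grid of mesh [|tau'| ^ k], which is arbitrarily
    small. *)
Lemma conjugate_dense x (e : R) :
  0 < e -> exists y y', conjugate y y' /\ `|x - y'| < e.
Proof.
move=> /tau'_expr_small [k ke].
pose z : R := tau' ^+ k; pose n := Num.floor (x / z).
have z0 : z != 0 by rewrite expf_neq0 ?tau'_neq0.
exists (n%:~R * tau ^+ k), (n%:~R * z); split.
  by apply: conjugateM (conjugate_int n) (conjugateX k conjugate_tau).
apply: le_lt_trans ke; rewrite -/z.
have -> : x - n%:~R * z = (x / z - n%:~R) * z by rewrite mulrBl mulfVK.
rewrite normrM ler_piMl //.
have := floor_le (x / z); have := floorD1_gt (x / z).
by rewrite -/n intrD ler_norml; lra.
Qed.

(** [v] lies in [Z[tau]^3] and [w] is its star image. *)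
Definition conjugates v w : Prop := forall i, conjugate (v 0 i) (w 0 i).

Lemma star_conjugates v w : conjugates v w -> star v = w.
Proof. by move=> vw; apply/rowP => i; rewrite mxE; exact: galois_conjugate. Qed.

End Conjugates.

(** * The icosian modules between [Z[tau]^3] and its half *)

Section IcosianModules.
Variable R : realType.
Implicit Types (v w : 'rV[R]_3) (q : 'rV[R]_4).

Lemma icosians0 : @icosians R 0.
Proof. by move=> M [[M0 _] _]; exact: set_mem M0. Qed.

Lemma icosiansB q r : icosians q -> icosians r -> icosians (q - r).
Proof.
move=> qI rI M MM; have [[_ MB] _] := MM.
by apply: set_mem; apply: MB; apply: mem_set; [exact: qI|exact: rI].
Qed.

Lemma icosiansD q r : icosians q -> icosians r -> icosians (q + r).
Proof.
move=> qI rI; rewrite -[r]opprK; apply: icosiansB => //.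
by rewrite -sub0r; apply: icosiansB => //; exact: icosians0.
Qed.

Lemma icosiansMz q (n : int) : icosians q -> icosians (q *~ n).
Proof.
move=> qI; have posI (m : nat) : icosians (q *+ m).
  by elim: m => [|m ih]; [exact: icosians0|rewrite mulrS; exact: icosiansD].
case: n => n; first exact: posI.
by rewrite NegzE mulrNz -sub0r; apply: icosiansB; [exact: icosians0|exact: posI].
Qed.

(** Transitivity of the alternating group: compose the transposition of [l] and
    [m] with that of the two remaining points.  It lets a single seed account
    for all coordinates at once. *)
Lemma even_perm_moving (l m : 'I_4) : exists s : 'S_4, ~~ odd_perm s /\ s l = m.
Proof.
have [->|lm] := eqVneq l m; first by exists 1%g; rewrite odd_perm1 perm1.
have : #|~: [set l; m]| == 2 by have := cardsC [set l; m]; rewrite cards2 lm card_ord => /(@addnI 2 _ 2) ->.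
move=> /cards2P [a [b [ab E]]].
have := set21 a b; have := set22 a b; rewrite -E !inE !negb_or.
move=> /andP[bl bm] /andP[al am].
exists (tperm l m * tperm a b)%g; split; first by rewrite odd_permM !odd_tperm lm ab.
by rewrite permM tpermL tpermD.
Qed.

Lemma generators_icosians s q :
  ~~ odd_perm s -> icosian_seeds q -> @icosians R (col_perm s q).
Proof. by move=> s0 qs; apply: sub_gen_smallest; exists s; split=> //; exists q. Qed.

Lemma delta_icosians (l : 'I_4) : @icosians R (delta_mx 0 l).
Proof.
have [s [s0 sl]] := even_perm_moving l ord0.
have -> : delta_mx 0 l = col_perm s (quat 1 0 0 0) :> 'rV[R]_4.
  apply/rowP => i; rewrite !mxE eqxx /= -(inj_eq (@perm_inj _ s)) sl.
  by case: (s i) => -[|[|[|[|]]]].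
by apply: generators_icosians => //; apply: Or31; exists false.
Qed.

(** Multiples by [tau] of the basis quaternions come from adding the two seeds
    [(0, 1, tau', tau) / 2] and [(0, -1, -tau', tau) / 2], whose middle
    coordinates cancel. *)
Lemma tau_delta_icosians (l : 'I_4) : @icosians R (tau *: delta_mx 0 l).
Proof.
have [s [s0 sl]] := even_perm_moving l ord_max.
pose h (e : bool) : 'rV[R]_4 :=
  2^-1 *: quat 0 ((-1) ^+ e) ((-1) ^+ e * tau') tau.
have -> : tau *: delta_mx 0 l = col_perm s (h false) + col_perm s (h true).
  apply/rowP => i; rewrite !mxE eqxx /= -(inj_eq (@perm_inj _ s)) sl.
  by case: (s i) => -[|[|[|[|]]]] //= _; field.
by apply: icosiansD; apply: generators_icosians => //; apply: Or33; do 2 eexists.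
Qed.

(** Quaternions with coordinates in [(1/2) Z[tau]] form an additive group
    containing all generators. *)
Lemma icosian_coordinates q i : icosians q -> exists y, conjugate (2 * q 0 i) y.
Proof.
move=> qI; move: i.
apply: (qI [set q | forall i, exists y, conjugate (2 * q 0 i) y]); split.
  split.
    apply/mem_set => i; exists 0; rewrite mxE mulr0; exact: (conjugate_int R 0).
  move=> x y /set_mem xM /set_mem yM; apply/mem_set => i.
  have [x' xx'] := xM i; have [y' yy'] := yM i; exists (x' - y').
  by rewrite !mxE mulrBr; apply: conjugateD => //; exact: conjugateN.
move=> _ [s [_ [v + ->]]] i; rewrite mxE; move: (s i) => {s}i.
have sgn (e : bool) : conjugate ((-1) ^+ e : R) ((-1) ^+ e).
  by apply: conjugateX; exact: (conjugate_int R (-1)).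
have c0 : conjugate (0 : R) 0 by exact: (conjugate_int R 0).
have c2 : conjugate (2 : R) 2 by exact: (conjugate_int R 2).
have ct' : conjugate (tau' : R) tau.
  by exists 1, (-1); rewrite /tau'; split; ring.
have two_half x : 2 * (2^-1 * x) = x :> R by rewrite mulrA divff ?mul1r ?pnatr_eq0.
case=> [[e ->]|[e1 [e2 [e3 [e4 ->]]]]|[e1 [e2 ->]]];
  rewrite !mxE ?two_half; case: i => -[|[|[|[|]]]] //= _;
  do 1?[by eexists; apply: sgn | by eexists; apply: c0 |
    by eexists; apply: conjugate_tau | by eexists; apply: conjugateM c2 _; by [apply: sgn|apply: c0]
   | by eexists; apply: conjugateM (sgn _) ct'].
Qed.

Variable L : set 'rV[R]_3.
Hypothesis hL : L = @ImI R \/ L = @I0 R.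

(** An element of [Z[tau]^3] is the imaginary part of an icosian with real part
    [0], which serves both modules at once. *)
Lemma conjugates_in_module v w : conjugates v w -> L v.
Proof.
move=> vw.
have [a ha] := fin_all_exists vw; have [b hb] := fin_all_exists ha.
pose q : 'rV[R]_4 := \sum_(i < 3) (delta_mx 0 (lift ord0 i) *~ a i
   + (tau *: delta_mx 0 (lift ord0 i)) *~ b i).
have qI : icosians q.
  apply: big_ind => [||i _]; first exact: icosians0.
    exact: icosiansD.
  by apply: icosiansD; apply: icosiansMz; [exact: delta_icosians|exact: tau_delta_icosians].
have qE j : q 0 j = \sum_(i < 3) (j == lift ord0 i)%:R * v 0 i.
  rewrite summxE; apply: eq_bigr => i _; have [-> _] := hb i.
  rewrite -(scaler_int (a i)) -(scaler_int (b i)) !mxE eqxx /=; ring.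
have q0 : q 0 0 = 0 by rewrite qE big1 // => i _; rewrite mul0r.
have qv : im q = v.
  apply/rowP => i; rewrite mxE qE (bigD1 i) //= eqxx mul1r big1 ?addr0 // => j ji.
  by rewrite (inj_eq lift_inj) eq_sym (negbTE ji) mul0r.
by case: hL => ->; exists q.
Qed.

Lemma double_module_conjugates v : L v -> exists w, conjugates (2 *: v) w.
Proof.
move=> Lv; have [q qI <-] : (@im R @` @icosians R) v.
  by case: hL Lv => -> // [q [qI _] <-]; exists q.
have [f hf] := fin_all_exists (fun i => icosian_coordinates (lift ord0 i) qI).
by exists (\row_i f i) => i; rewrite !mxE; exact: hf.
Qed.

End IcosianModules.

(** * Finite sets with equal X-rays *)

Lemma card_fset_set_seq (T : choiceType) (s : seq T) (A : set T) :
  uniq s -> #|` fset_set ([set` s] `&` A)|%fset = count (mem A) s.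
Proof.
move=> us; rewrite -size_filter.
have -> : fset_set ([set` s] `&` A) = [fset y in [seq y <- s | mem A y]]%fset.
  apply/fsetP => y; rewrite in_fset_set; last by apply: finite_setIl; exact: finite_seq.
  by rewrite !inE in_setI mem_filter andbC mem_setE.
by rewrite card_fseq undup_id ?filter_uniq.
Qed.

Section XrayCounts.
Variable R : realType.
Implicit Types (s t : seq 'rV[R]_3) (u v x y : 'rV[R]_3).

(** For a duplicate-free [s], the value of the X-ray of the set of its entries.
    Working with sequences makes disjoint unions and images under injections
    plain concatenations and maps. *)
Definition line_count u x s : nat := count (mem (line x u)) s.

Lemma line_count_affine u x s (c : R) v : c != 0 ->
  line_count u x [seq v + c *: y | y <- s] = line_count u (c^-1 *: (x - v)) s.
Proof.
move=> c0; rewrite /line_count count_map; apply: eq_count => y /=.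
apply/idP/idP => /set_mem [r _ E]; apply/mem_set.
  exists (c^-1 * r) => //; rewrite -scalerA -scalerDr addrAC E addrAC subrr add0r.
  by rewrite scalerA mulVf // scale1r.
exists (c * r) => //; rewrite -E scalerDr !scalerA divff // scale1r.
by rewrite addrA addrCA subrr addr0.
Qed.

Lemma line_count_translate u x s (r : R) :
  line_count u x [seq r *: u + y | y <- s] = line_count u x s.
Proof.
rewrite /line_count count_map; apply: eq_count => y /=.
apply/idP/idP => /set_mem [p _ E]; apply/mem_set.
  by exists (p - r) => //; rewrite scalerBl addrA E addrAC subrr add0r.
by exists (r + p) => //; rewrite -E scalerDl addrCA.
Qed.

Lemma line_count_affine_eq u s t (c : R) v : c != 0 ->
  (forall x, line_count u x s = line_count u x t) ->
  forall x, line_count u x [seq v + c *: y | y <- s]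
          = line_count u x [seq v + c *: y | y <- t].
Proof. by move=> c0 st x; rewrite !line_count_affine. Qed.

Lemma norm_bounded s : exists2 B : R, 0 <= B & {in s, forall x, `|x| <= B}.
Proof.
elim: s => [|y s [B B0 sB]]; first by exists 0.
exists (`|y| + B); first exact: addr_ge0.
move=> x; rewrite inE => /predU1P[->|/sB xB]; first by rewrite lerDl.
by rewrite (le_trans xB) // lerDr.
Qed.

(** It suffices that the translation be longer than the diameter of [s], hence
    the choice of [n] from a bound [B] on the norms of its entries. *)
Lemma uniq_cat_multiple_translate s v : v != 0 -> uniq s ->
  exists n : nat, uniq (s ++ [seq v *+ n + y | y <- s]).
Proof.
move=> v0 us; have [B B0 sB] := norm_bounded s.
have nv : 0 < `|v| by rewrite normr_gt0.
pose n := Num.bound ((B + B) / `|v|).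
have Bn : B + B < `|v| *+ n.
  rewrite -mulr_natr mulrC -ltr_pdivrMr //.
  by apply: archi_boundP; rewrite divr_ge0 // addr_ge0.
exists n; rewrite cat_uniq us map_inj_uniq ?us ?andbT; last exact: addrI.
apply/hasPn => _ /mapP[y ys ->]; apply/negP => /sB xB.
suff : `|v| *+ n <= B + B by rewrite leNgt Bn.
rewrite -normrMn -[X in `|X|](addrK y) (le_trans (ler_normB _ _)) //.
by apply: lerD => //; exact: sB.
Qed.

(** Induction on the directions, replacing [(s, t)] by [(s U (w + t), t U (w + s))]
    for a long enough [w] along the new direction.  Uniqueness of [s ++ t]
    records that the two sets are disjoint, so that they are distinct as soon as
    [s] is non-empty. *)
Lemma switching_component (P : 'rV[R]_3 -> Prop) (us : seq 'rV[R]_3) :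
  P 0 -> (forall x y, P x -> P y -> P (x + y)) ->
  {in us, forall u, exists r : R, P (r *: u) /\ r *: u != 0} ->
  exists s t, [/\ s != [::], uniq (s ++ t), {in s ++ t, forall x, P x} &
    {in us, forall u x, line_count u x s = line_count u x t}].
Proof.
move=> P0 PD; elim: us => [|u us ih] hus.
  by exists [:: 0], [::]; split => // x; rewrite inE => /eqP ->.
have [v vus|s [t [s0 ust Pst eqst]]] := ih.
  by apply: hus; rewrite inE vus orbT.
have [r [Pv v0]] := hus u (mem_head _ _).
have [n] := uniq_cat_multiple_translate v0 ust; set w := _ *+ n => uw.
have Pw : P w by rewrite /w; elim: (n) => // m; rewrite mulrS; exact: PD.
exists (s ++ [seq w + y | y <- t]), (t ++ [seq w + y | y <- s]).
have perm_st : perm_eq ((s ++ [seq w + y | y <- t]) ++ (t ++ [seq w + y | y <- s]))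
    ((s ++ t) ++ [seq w + y | y <- s ++ t]).
  by rewrite map_cat -!catA perm_cat2l perm_catCA perm_cat2l perm_catC.
split.
- by case: (s) s0.
- by rewrite (perm_uniq perm_st).
- move=> x; rewrite (perm_mem perm_st) mem_cat => /orP[/Pst//|/mapP[y /Pst Py ->]].
  exact: PD.
move=> u' + x; rewrite /line_count !count_cat -!/(line_count u' x _).
rewrite inE => /predU1P[->|u'us].
  have -> : w = (r *+ n) *: u by rewrite /w scalerMnl.
  by rewrite !line_count_translate addnC.
rewrite eqst //; congr addn.
have scale1 l : [seq w + y | y <- l] = [seq w + 1 *: y | y <- l].
  by apply: eq_map => y; rewrite scale1r.
by rewrite (scale1 s) (scale1 t); apply: line_count_affine_eq => [|y]; rewrite ?oner_neq0 ?eqst.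
Qed.

Lemma Xray_seq u s t : uniq s -> uniq t ->
  (forall x, line_count u x s = line_count u x t) ->
  Xray u [set` s] = Xray u [set` t].
Proof.
move=> us ut st; apply/funext => l; rewrite /Xray !card_fset_set_seq //.
by have /set_mem [x _ <-] := valP l; exact: st.
Qed.

End XrayCounts.

(** * Moving a finite configuration into the window *)

(** Around an interior point [p] of the window, half of the radius [e] is spent
    on approximating [p] by the star image of [w], the other half on shrinking
    the star images of [s] by [tau' ^ k]. *)
Lemma contract_into_window (R : realType) (W : set 'rV[R]_3)
    (s : seq 'rV[R]_3) :
  W° !=set0 -> {in s, forall x, exists y, conjugates x y} ->
  exists w k, {in s, forall x, exists2 y,
    conjugates (w + tau ^+ k *: x) y & W y}.
Proof.
move=> [p /nbhs_ballP [e /= e0 peW]] hs.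
have e20 : 0 < e / 2 by rewrite divr_gt0.
have [a ha] := fin_all_exists (fun i => conjugate_dense (p 0 i) e20).
have [b hb] := fin_all_exists ha.
have [B B0 sB] := norm_bounded (map (@star R) s).
have [k kB] := tau'_expr_small (divr_gt0 e20 (ltr_wpDl B0 ltr01)).
exists (\row_i a i), k => x xs; have [y xy] := hs x xs.
exists (\row_i b i + tau' ^+ k *: y).
  move=> i; rewrite !mxE; apply: conjugateD; first by have [] := hb i.
  exact: conjugateM (conjugateX k (conjugate_tau R)) (xy i).
apply: peW; split => // i j; rewrite ord1 /ball /= !mxE.
have yB : `|y 0 j| <= B.
  apply: le_trans (sB y _); last by rewrite -(star_conjugates xy) map_f.
  by rewrite /Num.Def.normr /= mx_normrE; apply: (le_bigmax _ (fun i => `|y i.1 i.2|) (0, j)).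
have [_ bj] := hb j.
rewrite opprD addrA (le_lt_trans (ler_normB _ _)) // [ltRHS](splitr e) ltrD //.
rewrite normrM; move: kB; rewrite ltr_pdivlMr ?ltr_wpDl //; apply: le_lt_trans.
by rewrite ler_wpM2l // (le_trans yB) // lerDl.
Qed.

Theorem proposition5p1 (R : realType)
    (L : set 'rV[R]_3) (hL : L = @ImI R \/ L = @I0 R)
    (t : 'rV[R]_3) (W : set 'rV[R]_3) (hW : window W)
    (U : set 'rV[R]_3) (finU : finite_set U)
    (dirU : forall u, U u -> Ldirection L u)
    (nparU : forall u v, U u -> U v -> u <> v -> ~ parallel u v) :
  ~ determined_by_Xrays (finite_subsets (model_set L t W)) U.
Proof.
have /finite_seqP [us UE] := finU.
pose P (x : 'rV[R]_3) := exists y, conjugates x y.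
have P0 : P 0 by exists 0 => i; rewrite mxE; exact: (conjugate_int R 0).
have PD x y : P x -> P y -> P (x + y).
  by move=> [x' xx'] [y' yy']; exists (x' + y') => i; rewrite !mxE; exact: conjugateD.
have dirP : {in us, forall u, exists r : R, P (r *: u) /\ r *: u != 0}.
  move=> u uus; have [|_ [al [La al0 [c c0 ->]]]] := dirU u; first by rewrite UE.
  (* u = c *: al, and doubling al puts it into Z[tau]^3. *)
  exists (2 / c); rewrite scalerA mulfVK //; split.
    exact: double_module_conjugates hL _ La.
  by rewrite scaler_eq0 (negbTE al0) pnatr_eq0.
have [s1 [s2 [s10 us12 Ps12 eq12]]] := switching_component P0 PD dirP.
have [W0 _ _ _] := hW.
have [w [k hwk]] := contract_into_window W0 Ps12.
have ck : (tau : R) ^+ k != 0 by rewrite expf_neq0 ?tau_neq0.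
pose f (x : 'rV[R]_3) := (t + w) + tau ^+ k *: x.
have f_inj : injective f by move=> x y /addrI /(scalerI ck).
have [us1 dis us2] : [/\ uniq s1, ~~ has (mem s1) s2 & uniq s2].
  by move: us12; rewrite cat_uniq => /and3P.
have subF (s : seq 'rV[R]_3) : {subset s <= s1 ++ s2} ->
    finite_subsets (model_set L t W) [set` map f s].
  move=> ss; split; first exact: finite_seq.
  move=> _ /= /mapP[x /ss /hwk [y xy Wy] ->]; exists (w + tau ^+ k *: x).
    by split; [exact: conjugates_in_module hL _ _ xy|rewrite (star_conjugates xy)].
  by rewrite /f addrA.
move=> /(_ [set` map f s1] [set` map f s2]) det.
have : [set` map f s1] = [set` map f s2].
  apply: det; try by apply: subF => x xs; rewrite mem_cat xs ?orbT.
  rewrite UE => u /= uus; apply: Xray_seq; rewrite ?map_inj_uniq //.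
  by apply: line_count_affine_eq => //; exact: eq12.
case: s1 s10 dis {us12 Ps12 eq12 hwk us1 subF det} => // x s1 _ dis.
move=> /seteqP [/(_ (f x))] /=; rewrite mem_head => /(_ isT) /mapP [y ys2 /f_inj xy] _.
by move/hasPn: dis => /(_ y ys2) /=; rewrite -xy mem_head.
Qed.
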